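(* For any automorphism $\varphi$ of $\Pi_2^+$, with $\varphi'=\varphi|_{\Gamma_A}$, $$R(\varphi)=\begin{cases}4&\text{if }\varphi\text{ is of type (II) and }\det\varphi'=-1;\\ \infty&\text{otherwise.}\end{cases}$$ Moreover, the group $\Pi_2^-$ has the $R_\infty$ property.
   Context: Let $A=[\ell_{ij}]\in\mathrm{SL}(2,\mathbb{Z})$ have trace $>2$. For $\mathbf{x}=(x,y)^t\in\mathbb{Z}^2$ write $\mathbf{a}^{\mathbf{x}}=a_1^xa_2^y$; for an integer matrix $B=[b_{ij}]$ write $B(a_i)=a_1^{b_{1i}}a_2^{b_{2i}}$. Let $$N_\pm=-\frac{1}{\sqrt{\ell_{11}+\ell_{22}\pm2}}\begin{bmatrix}\ell_{11}\pm1&\ell_{12}\\ \ell_{21}&\ell_{22}\pm1\end{bmatrix},$$ which is a square root of $A$. The group $\Pi_2^{+}$ (resp. $\Pi_2^-$) is considered when $N_+$ (resp. $N_-$) has integer entries, and $$\Pi_2^\pm=\langle a_1,a_2,\beta\mid [a_1,a_2]=1,\ \beta a_i\beta^{-1}=N_\pm(a_i)\ (i=1,2)\rangle.$$ Let $\Gamma_A=\langle a_1,a_2,t\rangle\subset\Pi_2^\pm$ with $t=\beta^2$; this is isomorphic to $\langle a_1,a_2,t\mid[a_1,a_2]=1,\ ta_it^{-1}=A(a_i)\rangle$, and it is a fully invariant subgroup of $\Pi_2^\pm$. An automorphism $\varphi$ restricts to $\varphi'=\varphi|_{\Gamma_A}$ with $\varphi'(a_i)=\mathbf{a}^{\mathbf{n}_i}$,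 $\varphi'(t)=\mathbf{a}^{\mathbf{p}}t^m$; $\varphi$ (or $\varphi'$) is of type (I) if $m=1$, (II) if $m=-1$, (III) if $m\ne\pm1$; and $\det\varphi'=m\det[\mathbf{n}_1\ \mathbf{n}_2]$. The Reidemeister number $R(\varphi)$ of an endomorphism $\varphi$ of a group $G$ is the number (possibly $\infty$) of equivalence classes of the relation $\alpha\sim\gamma\alpha\varphi(\gamma)^{-1}$ ($\gamma\in G$) on $G$. $G$ has the $R_\infty$ property if $R(\varphi)=\infty$ for every automorphism $\varphi$ of $G$. *)

(* Defs.v *)
From HB Require Import structures.
From mathcomp Require Import all_boot all_order all_algebra.
From mathcomp Require Import finmap all_classical.
From mathcomp Require Import reals constructive_ereal.

Set Implicit Arguments.
Unset Strict Implicit.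
Unset Printing Implicit Defensive.

Import Order.TTheory GRing.Theory Num.Theory.

Local Open Scope classical_set_scope.
Local Open Scope ring_scope.

Section PresentedGroup.

(* The letter (x, false) stands for the generator x, and (x, true) for its
   inverse. *)
Definition word (X : choiceType) : Type := seq (X * bool).

Definition flip_letter (X : choiceType) (l : X * bool) : X * bool :=
  (l.1, ~~ l.2).

Definition word_inv (X : choiceType) (w : word X) : word X :=
  rev (map (@flip_letter X) w).

Definition letter_exp (X : choiceType) (x : X) (k : int) : word X :=
  nseq `|k|%N (x, k < 0).

Variables (X : choiceType) (rels : seq (word X * word X)).

(* A pair (u, v) in rels is the defining relation u = v. *)
Inductive pres_eq : word X -> word X -> Prop :=
| pres_refl u : pres_eq u u
| pres_sym u v : pres_eq u v -> pres_eq v u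
| pres_trans u v w : pres_eq u v -> pres_eq v w -> pres_eq u w
| pres_cat u u' v v' :
    pres_eq u u' -> pres_eq v v' -> pres_eq (u ++ v) (u' ++ v')
| pres_cancel l : pres_eq [:: l; flip_letter l] [::]
| pres_rel r : r \in rels -> pres_eq r.1 r.2.

Definition pres_eqb : rel (word X) := fun u v => `[< pres_eq u v >].

Lemma pres_eqb_refl : reflexive pres_eqb.
Proof. by move=> u; apply/asboolP/pres_refl. Qed.

Lemma pres_eqb_sym : symmetric pres_eqb.
Proof. by move=> u v; apply/asboolP/asboolP; apply: pres_sym. Qed.

Lemma pres_eqb_trans : transitive pres_eqb.
Proof.
by move=> v u w /asboolP uv /asboolP vw; apply/asboolP/(pres_trans uv vw).
Qed.

Canonical pres_equiv :=
  EquivRel pres_eqb pres_eqb_refl pres_eqb_sym pres_eqb_trans.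

Definition presented : Type := {eq_quot pres_equiv}%qT.

HB.instance Definition _ := Choice.on presented.
HB.instance Definition _ := EqQuotient.on presented.

Definition pres_class (w : word X) : presented := \pi_presented%qT w.

Lemma pres_classP (u v : word X) :
  pres_class u = pres_class v <-> pres_eq u v.
Proof.
split=> [/eqP|uv]; first by rewrite /pres_class piE => /asboolP.
by apply/eqP; rewrite /pres_class piE; apply/asboolP.
Qed.

Lemma pres_class_repr (x : presented) : pres_class (repr x) = x.
Proof. exact: reprK. Qed.

Definition pres_mul (x y : presented) := pres_class (repr x ++ repr y).
Definition pres_inv (x : presented) := pres_class (word_inv (repr x)).
Definition pres_one := pres_class [::].

Lemma pres_mulE (u v : word X) :
  pres_mul (pres_class u) (pres_class v) = pres_class (u ++ v).
Proof.
by apply/pres_classP; apply: pres_cat; apply/pres_classP/pres_class_repr.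
Qed.

Lemma flip_letterK : involutive (@flip_letter X).
Proof. by case=> x b; rewrite /flip_letter /= negbK. Qed.

Lemma pres_eq_mulV (w : word X) : pres_eq (w ++ word_inv w) [::].
Proof.
elim: w => [|l w IHw]; first exact: pres_refl.
rewrite /word_inv map_cons rev_cons -cats1 -[l :: w]cat1s.
apply: pres_trans (pres_cancel l).
rewrite -[[:: l; _]]/([:: l] ++ [::] ++ [:: flip_letter l]) -!catA.
apply: pres_cat; first exact: pres_refl.
by rewrite catA; apply: pres_cat; [exact: IHw | exact: pres_refl].
Qed.

Lemma word_invK (w : word X) : word_inv (word_inv w) = w.
Proof. by rewrite /word_inv map_rev revK (mapK flip_letterK). Qed.

Lemma pres_mulA : associative pres_mul.
Proof.
move=> x y z; rewrite -(pres_class_repr x) -(pres_class_repr y).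
by rewrite -(pres_class_repr z) !pres_mulE catA.
Qed.

Lemma pres_mul1 : left_id pres_one pres_mul.
Proof. by move=> x; rewrite -(pres_class_repr x) pres_mulE. Qed.

Lemma pres_mulx1 : right_id pres_one pres_mul.
Proof. by move=> x; rewrite -(pres_class_repr x) pres_mulE cats0. Qed.

Lemma pres_mulxV : right_inverse pres_one pres_inv pres_mul.
Proof.
move=> x; rewrite -{1}(pres_class_repr x) pres_mulE.
exact/pres_classP/pres_eq_mulV.
Qed.

Lemma pres_mulVx : left_inverse pres_one pres_inv pres_mul.
Proof.
move=> x; rewrite -{2}(pres_class_repr x) pres_mulE.
apply/pres_classP; rewrite -{2}[repr x]word_invK; exact: pres_eq_mulV.
Qed.

HB.instance Definition _ := isGroup.Build presented
  pres_mulA pres_mul1 pres_mulx1 pres_mulVx pres_mulxV.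

Definition pres_gen (x : X) : presented := pres_class [:: (x, false)].

End PresentedGroup.

Section Reidemeister.

Local Open Scope group_scope.

Definition expgz (G : groupType) (x : G) (k : int) : G :=
  match k with
  | Posz n => x ^+ n
  | Negz n => x ^- n.+1
  end.

Definition twisted_class (G : groupType) (phi : G -> G) (x : G) : set G :=
  [set y | exists g : G, y = g * x * (phi g)^-1].

Definition ecard (T : choiceType) (S : set T) : \bar nat :=
  if `[< finite_set S >] then (#|` fset_set S|%fset)%:E else +oo%E.

Definition reidemeister_number (G : groupType) (phi : G -> G) : \bar nat :=
  ecard (range (twisted_class phi)).

Definition R_infinity (G : groupType) : Prop :=
  forall phi : {multiplicative G -> G},
    bijective phi -> reidemeister_number phi = +oo%E.

End Reidemeister.

Section Pi2.

(* With e = 1 this is N_+, with e = -1 it is N_-. *)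
Definition root_mx (R : realType) (A : 'M[int]_2) (e : int) : 'M[R]_2 :=
  - (Num.sqrt (\tr A + 2 * e)%:~R)^-1 *: map_mx intr (A + e%:M).

Definition is_integral_form (R : realType) (M : 'M[R]_2) (N : 'M[int]_2) :
  Prop := M = map_mx intr N.

(* The generators are Some 0 for a_1, Some 1 for a_2 and None for beta. *)
Definition a_word (x : 'cV[int]_2) : word (option 'I_2) :=
  letter_exp (Some 0) (x 0 0) ++ letter_exp (Some 1) (x 1 0).

Definition Pi2_rels (N : 'M[int]_2) :
    seq (word (option 'I_2) * word (option 'I_2)) :=
  ([:: (Some 0, false); (Some 1, false); (Some 0, true); (Some 1, true)], [::])
  :: [seq ([:: (None, false); (Some i, false); (None, true)], a_word (col i N))
     | i <- enum 'I_2].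

Definition Pi2 (N : 'M[int]_2) : groupType := presented (Pi2_rels N).

Variable N : 'M[int]_2.

Local Open Scope group_scope.

Definition gen_a (i : 'I_2) : Pi2 N := pres_gen (Pi2_rels N) (Some i).
Definition gen_beta : Pi2 N := pres_gen (Pi2_rels N) None.
Definition gen_t : Pi2 N := gen_beta ^+ 2.

Definition a_exp (x : 'cV[int]_2) : Pi2 N :=
  expgz (gen_a 0%R) (x 0%R 0%R) * expgz (gen_a 1%R) (x 1%R 0%R).

(* A morphism on Gamma_A = <a_1, a_2, t> is given by its values at a_1, a_2
   and t; n is the matrix with columns n_1 and n_2.  As elements a^x t^k have
   unique exponents, at most one triple (n, p, m) is possible. *)
Definition restriction_data (phi : Pi2 N -> Pi2 N)
    (n : 'M[int]_2) (p : 'cV[int]_2) (m : int) : Prop :=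
  (forall i, phi (gen_a i) = a_exp (col i n)) /\
  phi gen_t = a_exp p * expgz gen_t m.

Definition is_type_II (phi : Pi2 N -> Pi2 N) : Prop :=
  exists (n : 'M[int]_2) (p : 'cV[int]_2),
    restriction_data phi n p (-1)%R.

Definition det_restriction_eq (phi : Pi2 N -> Pi2 N) (d : int) : Prop :=
  exists (n : 'M[int]_2) (p : 'cV[int]_2) (m : int),
    restriction_data phi n p m /\ d = (m * \det n)%R.

End Pi2.

(* Main.v *)
Require Import Defs.
From HB Require Import structures.
From mathcomp Require Import all_boot all_order all_algebra.
From mathcomp Require Import finmap all_classical.
From mathcomp Require Import reals constructive_ereal.
From mathcomp Require Import zify ring.

(** Write G for the presented group and e = +1 or -1 for the sign in N_+, N_-.

    Structure.  G is the semidirect product of Z^2 by Z with beta acting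
    through N: the relations allow every element to be written a^x beta^k
    (coordE), and the concrete semidirect product, a quotient of G by the
    universal property, shows that the vector x and the height k are
    determined by the element.  The formula for N gives det N = e and
    (tr N)^2 = tr A + 2 e (integral_root_invariants), so 1 is not an
    eigenvalue of N.

    Automorphisms.  The height of phi (a^x) vanishes for x in
    (1 - N) Z^2, which has finite index, hence for all x, so phi (a^x) = a^(P x) for an
    integer matrix P of determinant 1 or -1, and phi multiplies heights by
    some m = 1 or -1.  Applying phi to the relations gives N^m P = P N.  On
    t = beta^2 the same m appears as exponent, so m is the type of phi and
    the determinant of the restriction is m det P.

    Counting.  If m = 1, the height is a twisted conjugacy invariant and
    there are infinitely many classes.  If m = -1, then P conjugates N to
    N^-1.  When det N = -1 this is impossible, because tr N^-1 = - tr N and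
    tr N is not 0; hence R_infinity for N_-.  When det N = 1 it forces
    tr P = tr (N P) = 0 (inverting_traces0; geometrically, P exchanges the two
    eigenlines of N).  Twisted conjugation by an element of height k changes
    heights by 2 k, so the classes are those of height 0 and those of
    height 1, and these are the cokernels of 1 - P and 1 - N P.  For
    det P = -1 one has det (1 - P) = 0 and the first cokernel is infinite;
    for det P = 1 both determinants are 2 and there are 2 + 2 classes. *)

Set Implicit Arguments.
Unset Strict Implicit.
Unset Printing Implicit Defensive.

Import Order.TTheory GRing.Theory Num.Theory.

Local Open Scope classical_set_scope.
Local Open Scope ring_scope.

(** * Integer powers and group morphisms *)

Section GroupPowers.
Variables G H : groupType.
Implicit Types (x y : G) (k l : int).

Lemma expgzS x k : expgz x (k + 1) = (x * expgz x k)%g.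
Proof.
case: k => [n|[|n]].
  have -> : Posz n + 1 = n.+1 by lia.
  by rewrite /= expgS.
  by rewrite [RHS]mulgV.
have -> : Negz n.+1 + 1 = Negz n by lia.
by rewrite /= [X in _ = (_ * X^-1)%g]expgSr invgM mulVKg.
Qed.

Lemma expgzD x k l : expgz x (k + l) = (expgz x k * expgz x l)%g.
Proof.
elim: k => [|n IHn|n IHn]; first by rewrite add0r /= mul1g.
  by rewrite intS [1 + _]addrC addrAC !expgzS IHn mulgA.
apply: (mulgI x); rewrite mulgA -!expgzS.
have -> : - n.+1%:Z + 1 = - n%:Z by lia.
by rewrite -IHn; congr (expgz x _); lia.
Qed.

Lemma commute_expgz x y k : commute x y -> commute x (expgz y k).
Proof. by case: k => n xy; [|apply: commuteV]; apply: commuteX. Qed.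

Lemma expgz_scale (V : lmodType int) (f : V -> G) :
  {morph f : v w / v + w >-> (v * w)%g} ->
  forall v k, expgz (f v) k = f (k *: v).
Proof.
move=> fD v k; rewrite -[k]intz scaler_int intz.
have f0 : f 0 = 1%g by apply: (mulgI (f 0)); rewrite -fD mulg1 addr0.
have fX n : (f v ^+ n)%g = f (v *+ n).
  by elim: n => [|n IHn]; rewrite ?expg0 ?f0 // expgS IHn -fD -mulrS.
case: k => n; rewrite /= fX //; apply: mulg1_eq.
by rewrite -fD NegzE mulrNz addrN.
Qed.

Section Morphism.
Variables (f : G -> H) (fM : {morph f : x y / (x * y)%g}).

Lemma morphg1 : f 1%g = 1%g.
Proof. by apply: (mulgI (f 1%g)); rewrite -fM !mulg1. Qed.

Lemma morphgV x : f (x^-1)%g = ((f x)^-1)%g.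
Proof. by apply/esym/mulg1_eq; rewrite -fM mulgV morphg1. Qed.

Lemma morphg_expgz x k : f (expgz x k) = expgz (f x) k.
Proof.
have fX n : f (x ^+ n)%g = (f x ^+ n)%g.
  by elim: n => [|n IHn]; rewrite ?expg0 ?morphg1 // !expgS fM IHn.
by case: k => n /=; rewrite ?morphgV fX.
Qed.

End Morphism.
End GroupPowers.

(** * The universal property of a presented group *)

Section PresentedLift.
Variables (X : choiceType) (rels : seq (word X * word X)).

Section Values.
Variables (G : groupType) (f : X -> G).

Definition word_value (w : word X) : G :=
  (\prod_(l <- w) if l.2 then (f l.1)^-1 else f l.1)%g.

Lemma word_value_cat u v :
  word_value (u ++ v) = (word_value u * word_value v)%g.
Proof. exact: big_cat. Qed.

Lemma word_value_letter_exp x k : word_value (letter_exp x k) = expgz (f x) k.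
Proof.
rewrite /word_value /letter_exp big_nseq iter_mulg_1.
by case: k => n //=; rewrite expVgn.
Qed.

Hypothesis frel : forall r, r \in rels -> word_value r.1 = word_value r.2.

Lemma word_value_pres_eq u v : pres_eq rels u v -> word_value u = word_value v.
Proof.
elim=> // [{}u {}v w _ -> //|{}u u' {}v v' _ IHu _ IHv|[x b]].
  by rewrite !word_value_cat IHu IHv.
rewrite /word_value !big_cons big_nil mulg1.
by case: b; rewrite /= (mulgV, mulVg).
Qed.

Definition pres_lift (g : presented rels) : G := word_value (repr g).

Lemma pres_lift_class w : pres_lift (pres_class rels w) = word_value w.
Proof.
by apply: word_value_pres_eq; apply/pres_classP; rewrite pres_class_repr.
Qed.

Lemma pres_liftM : {morph pres_lift : g h / (g * h)%g}.
Proof. by move=> g h; rewrite [LHS]pres_lift_class word_value_cat. Qed.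

Lemma pres_lift_gen x : pres_lift (pres_gen rels x) = f x.
Proof. by rewrite pres_lift_class /word_value big_seq1. Qed.

End Values.

(** This turns the defining relations, which are identities between words, into
    identities between products of generators. *)
Lemma word_value_gen w : word_value (pres_gen rels) w = pres_class rels w.
Proof.
elim: w => [|[x b] w IHw]; first by rewrite /word_value big_nil.
rewrite /word_value big_cons -/(word_value _ w) IHw -cat1s.
rewrite -[pres_class _ (_ ++ _)]pres_mulE; congr (_ * _)%g.
case: b => //=; apply/mulg1_eq.
by rewrite [LHS]pres_mulE; apply/pres_classP/(pres_cancel rels (x, false)).
Qed.

Lemma pres_gen_rel r : r \in rels ->
  word_value (pres_gen rels) r.1 = word_value (pres_gen rels) r.2.
Proof. by move=> rr; rewrite !word_value_gen; apply/pres_classP/pres_rel. Qed.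

(** Induction on a representing word, starting from its last letter. *)
Lemma presented_ind (P : presented rels -> Prop) :
  P 1%g ->
  (forall x g, P g -> P (pres_gen rels x * g)%g) ->
  (forall x g, P g -> P ((pres_gen rels x)^-1 * g)%g) ->
  forall g, P g.
Proof.
move=> P1 Pgen PgenV g; rewrite -(pres_class_repr g) -word_value_gen.
elim: (repr g) => [|[x b] w IHw]; first by rewrite /word_value big_nil.
by rewrite /word_value big_cons; case: b; [apply: PgenV | apply: Pgen].
Qed.

End PresentedLift.

(** * The semidirect product of Z^n by the powers of an invertible matrix *)

Section SemidirectProduct.
Variables (n : nat) (N : 'M[int]_n.+1) (uN : N \is a GRing.unit).

(** The invertibility of N is a parameter of the type, since the law below
    is a group law only under this condition. *)
Definition semidirect (_ : N \is a GRing.unit) : Type :=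
  ('cV[int]_n.+1 * int)%type.

HB.instance Definition _ := Choice.on (semidirect uN).

Definition sd_mul (g h : semidirect uN) : semidirect uN :=
  (g.1 + N ^ g.2 *m h.1, g.2 + h.2).
Definition sd_one : semidirect uN := (0, 0).
Definition sd_inv (g : semidirect uN) : semidirect uN :=
  (- (N ^ (- g.2) *m g.1), - g.2).

Lemma mulmx_exprzD k l (x : 'cV[int]_n.+1) :
  N ^ k *m (N ^ l *m x) = N ^ (k + l) *m x.
Proof. by rewrite mulmxA mulmxE -exprzDr. Qed.

Lemma sd_mulA : associative sd_mul.
Proof.
by move=> g h i; rewrite /sd_mul /= mulmxDr mulmx_exprzD !addrA.
Qed.

Lemma sd_mul1 : left_id sd_one sd_mul.
Proof. by case=> x k; rewrite /sd_mul /= expr0z mul1mx !add0r. Qed.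

Lemma sd_mulx1 : right_id sd_one sd_mul.
Proof. by case=> x k; rewrite /sd_mul /= mulmx0 !addr0. Qed.

Lemma sd_mulVx : left_inverse sd_one sd_inv sd_mul.
Proof. by case=> x k; rewrite /sd_mul /sd_inv /= !addNr. Qed.

Lemma sd_mulxV : right_inverse sd_one sd_inv sd_mul.
Proof.
case=> x k; rewrite /sd_mul /sd_inv /= mulmxN mulmx_exprzD !subrr.
by rewrite expr0z mul1mx subrr.
Qed.

HB.instance Definition _ := isGroup.Build (semidirect uN)
  sd_mulA sd_mul1 sd_mulx1 sd_mulVx sd_mulxV.

Definition sd_vec (x : 'cV[int]_n.+1) : semidirect uN := (x, 0).
Definition sd_shift : semidirect uN := (0, 1).

Lemma sd_vecD x y : sd_vec (x + y) = (sd_vec x * sd_vec y)%g.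
Proof. by congr pair; rewrite /= expr0z mul1mx. Qed.

End SemidirectProduct.

(** * Vector and height of an element of Pi2 *)

Lemma ord2_case (i : 'I_2) : i = 0 \/ i = 1.
Proof. by case: i => [[|[|//]] ?]; [left | right]; apply: val_inj. Qed.

Lemma sum_ord2 (V : nmodType) (F : 'I_2 -> V) : \sum_i F i = F 0 + F 1.
Proof. by rewrite big_ord_recl big_ord1; congr (_ + F _); apply: val_inj. Qed.

Lemma mulmx_col2 (M : 'M[int]_2) (x : 'cV[int]_2) :
  M *m x = x 0 0 *: col 0 M + x 1 0 *: col 1 M.
Proof. by apply/colP=> i; rewrite !mxE sum_ord2 ![M _ _ * _]mulrC. Qed.

Section Coordinates.
Variables (N : 'M[int]_2) (uN : N \is a GRing.unit).

Local Notation G := (Pi2 N).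
Local Notation beta := (gen_beta N).

Definition sd_gen (l : option 'I_2) : semidirect uN :=
  if l is Some i then sd_vec uN (delta_mx i 0) else sd_shift uN.

Lemma sd_shift_vec x :
  (sd_shift uN * sd_vec uN x = sd_vec uN (N *m x) * sd_shift uN)%g.
Proof.
by congr pair; rewrite /= ?expr0z ?expr1z ?mulmx0 ?addr0 ?add0r.
Qed.

Lemma sd_vec_gens (x : 'cV[int]_2) :
  (expgz (sd_gen (Some 0%R)) (x 0%R 0%R) *
   expgz (sd_gen (Some 1%R)) (x 1%R 0%R))%g
  = sd_vec uN x.
Proof.
rewrite !(expgz_scale (sd_vecD uN)) -sd_vecD; congr sd_vec.
by rewrite -[RHS]mul1mx mulmx_col2 !col1.
Qed.

Lemma word_value_a_word (H : groupType) (f : option 'I_2 -> H)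
    (x : 'cV[int]_2) :
  word_value f (a_word x) =
    (expgz (f (Some 0%R)) (x 0%R 0%R) * expgz (f (Some 1%R)) (x 1%R 0%R))%g.
Proof. by rewrite word_value_cat !word_value_letter_exp. Qed.

Lemma sd_gen_rel r : r \in Pi2_rels N ->
  word_value sd_gen r.1 = word_value sd_gen r.2.
Proof.
rewrite inE => /orP[/eqP -> | /mapP[i _ ->]].
  have vC x y : (sd_vec uN x * sd_vec uN y = sd_vec uN y * sd_vec uN x)%g.
    by rewrite -!sd_vecD addrC.
  rewrite /word_value !big_cons !big_nil /= mulg1 mulgA.
  by rewrite (vC (delta_mx 0 0)) -mulgA mulVKg mulgV.
rewrite [RHS]word_value_a_word sd_vec_gens colE.
rewrite /word_value !big_cons !big_nil /= mulg1 mulgA.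
by rewrite sd_shift_vec mulgK.
Qed.

Definition coord : G -> semidirect uN := pres_lift sd_gen.
Definition vec (g : G) : 'cV[int]_2 := (coord g).1.
Definition ht (g : G) : int := (coord g).2.

Let coordM : {morph coord : g h / (g * h)%g}.
Proof. exact: pres_liftM sd_gen_rel. Qed.

Lemma vecM g h : vec (g * h)%g = vec g + N ^ ht g *m vec h.
Proof. by rewrite /vec coordM. Qed.

Lemma htM g h : ht (g * h)%g = ht g + ht h.
Proof. by rewrite /ht coordM. Qed.

Lemma coord_a_exp x : coord (a_exp N x) = sd_vec uN x.
Proof.
by rewrite coordM !(morphg_expgz coordM) /coord !pres_lift_gen ?sd_vec_gens //;
  apply: sd_gen_rel.
Qed.

Lemma vec_a_exp x : vec (a_exp N x) = x.
Proof. by rewrite /vec coord_a_exp. Qed.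

Lemma ht_a_exp x : ht (a_exp N x) = 0.
Proof. by rewrite /ht coord_a_exp. Qed.

Lemma ht_beta : ht beta = 1.
Proof. by rewrite /ht /coord pres_lift_gen //; apply: sd_gen_rel. Qed.

Lemma ht1 : ht 1%g = 0.
Proof. by rewrite /ht (morphg1 coordM). Qed.

Lemma htV g : ht (g^-1)%g = - ht g.
Proof. by rewrite /ht (morphgV coordM). Qed.

Lemma ht_expgz g k : ht (expgz g k) = k * ht g.
Proof.
elim: k => [|n IHn|n IHn]; first by rewrite ht1 mul0r.
  by rewrite intS addrC expgzD htM IHn mulrDl mul1r.
have -> : - n.+1%:Z = - n%:Z - 1 by lia.
by rewrite expgzD htM IHn mulrDl mulN1r htV.
Qed.

Lemma vec_beta : vec beta = 0.
Proof. by rewrite /vec /coord pres_lift_gen //; apply: sd_gen_rel. Qed.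

Lemma vec_expgz0 g k : vec g = 0 -> vec (expgz g k) = 0.
Proof.
move=> g0; have vV h : vec h = 0 -> vec (h^-1)%g = 0.
  by move=> h0; rewrite /vec (morphgV coordM) /= -/(vec h) h0 mulmx0 oppr0.
have vX n : vec (g ^+ n)%g = 0.
  elim: n => [|n IHn]; last by rewrite expgS vecM IHn g0 mulmx0 addr0.
  by rewrite /vec (morphg1 coordM).
by case: k => n; [|apply: vV]; apply: vX.
Qed.

Lemma vec_beta_exp k : vec (expgz beta k) = 0.
Proof. exact/vec_expgz0/vec_beta. Qed.

(** * Normal forms in Pi2 *)

Lemma gen_a_commute i j : commute (gen_a N i) (gen_a N j).
Proof.
have c01 : commute (gen_a N 0) (gen_a N 1).
  have /pres_gen_rel := mem_head _ _ : ([:: (Some 0, false); (Some 1, false);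
    (Some 0, true); (Some 1, true)], [::]) \in Pi2_rels N.
  rewrite /word_value !big_cons !big_nil /= mulg1 => c.
  by apply/divg1_eq; rewrite invgM -mulgA.
by case: (ord2_case i) (ord2_case j) => -> [] ->; rewrite ?commute_refl //;
  apply: commute_sym.
Qed.

Lemma a_expD : {morph a_exp N : x y / x + y >-> (x * y)%g}.
Proof.
move=> x y; rewrite /a_exp !mxE !expgzD -!mulgA; congr (_ * _)%g.
rewrite !mulgA; congr (_ * _)%g.
exact/commute_expgz/commute_sym/commute_expgz/gen_a_commute.
Qed.

Lemma a_exp_delta i : a_exp N (delta_mx i 0) = gen_a N i.
Proof.
by case: (ord2_case i) => ->; rewrite /a_exp !mxE /= ?mulg1 ?mul1g.
Qed.

(** Used for conjugation by beta, where M = N, and for the endomorphisms whose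
    twisted classes are counted. *)
Lemma morph_a_exp (f : G -> G) (M : 'M[int]_2) :
  {morph f : g h / (g * h)%g} ->
  (forall i, f (gen_a N i) = a_exp N (col i M)) ->
  forall x, f (a_exp N x) = a_exp N (M *m x).
Proof.
move=> fM fa x; rewrite {1}/a_exp fM !(morphg_expgz fM) !fa.
by rewrite !(expgz_scale a_expD) -a_expD mulmx_col2.
Qed.

Lemma beta_a_exp x : (beta * a_exp N x = a_exp N (N *m x) * beta)%g.
Proof.
pose f g := (beta * g * beta^-1)%g.
have fM : {morph f : g h / (g * h)%g} by move=> g h; rewrite /f !mulgA mulgVK.
have fa i : f (gen_a N i) = a_exp N (col i N).
  have /pres_gen_rel : ([:: (None, false); (Some i, false); (None, true)],
      a_word (col i N)) \in Pi2_rels N.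
    rewrite inE; apply/orP; right; apply/mapP.
    by exists i => //; rewrite mem_enum.
  rewrite /= word_value_a_word /word_value !big_cons big_nil /= mulg1 mulgA.
  exact.
by rewrite -(morph_a_exp fM fa) /f mulgVK.
Qed.

Lemma coordE g : g = (a_exp N (vec g) * expgz beta (ht g))%g.
Proof.
suff [x [k ->]] : exists x k, g = (a_exp N x * expgz beta k)%g.
  by rewrite vecM htM vec_a_exp ht_a_exp vec_beta_exp ht_expgz ht_beta
    mulmx0 addr0 add0r mulr1.
have aE i : pres_gen (Pi2_rels N) (Some i) = a_exp N (delta_mx i 0).
  by rewrite a_exp_delta.
elim/presented_ind: g => [|[i|] _ [x [k ->]]|[i|] _ [x [k ->]]].
- by exists 0, 0; rewrite /= mulg1 /a_exp !mxE /= mulg1.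
- by exists (delta_mx i 0 + x), k; rewrite aE a_expD mulgA.
- exists (N *m x), (k + 1).
  by rewrite -/beta mulgA beta_a_exp expgzS mulgA.
- exists (- delta_mx i 0 + x), k; rewrite aE a_expD mulgA; congr (_ * _ * _)%g.
  apply: mulg1_eq; rewrite -a_expD addrN; by rewrite /a_exp !mxE /= mulg1.
exists (N^-1 *m x), (k - 1); rewrite -/beta; apply: (mulgI beta).
rewrite mulVKg mulgA beta_a_exp mulmxA mulmxE divrr //.
by rewrite mul1mx -[RHS]mulgA -expgzS subrK.
Qed.

Lemma coord_inj g h : vec g = vec h -> ht g = ht h -> g = h.
Proof. by move=> vgh hgh; rewrite (coordE g) (coordE h) vgh hgh. Qed.

Lemma a_exp_inj : injective (a_exp N).
Proof. exact: can_inj vec_a_exp. Qed.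

End Coordinates.

(** * Integral 2 x 2 matrices *)

Section Matrices2.
Variable R : comNzRingType.
Implicit Types M : 'M[R]_2.

Lemma mxtrace2 M : \tr M = M 0 0 + M 1 1.
Proof. exact: sum_ord2. Qed.

Lemma det2 M : \det M = M 0 0 * M 1 1 - M 0 1 * M 1 0.
Proof.
rewrite (expand_det_row _ 0) sum_ord2 /cofactor !det_mx11 !mxE /=.
rewrite expr0 expr1 mul1r mulN1r mulrN.
by congr (_ * M _ _ - _ * M _ _); apply: val_inj.
Qed.

Lemma matrix2P M M' : M 0 0 = M' 0 0 -> M 0 1 = M' 0 1 ->
  M 1 0 = M' 1 0 -> M 1 1 = M' 1 1 -> M = M'.
Proof.
by move=> e00 e01 e10 e11; apply/matrixP=> i j;
  case: (ord2_case i) (ord2_case j) => -> [] ->.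
Qed.

Lemma mxtraceMC M M' : \tr (M * M') = \tr (M' * M).
Proof. by rewrite -mulmxE mxtrace_mulC. Qed.

Lemma cayley_hamilton2 M : M * M = \tr M *: M - (\det M)%:M.
Proof.
by apply: matrix2P;
  rewrite -mulmxE !mxE sum_ord2 /= mxtrace2 det2 ?mulr1n ?mulr0n; ring.
Qed.

Lemma det_sub1 M : \det (1 - M) = 1 - \tr M + \det M.
Proof. by rewrite !det2 mxtrace2 !mxE /= !mulr0n !mulr1n; ring. Qed.

End Matrices2.

Lemma intmul_eq1 (a b : int) : a * b = 1 -> a = 1 \/ a = -1.
Proof.
move=> /(congr1 absz); rewrite abszM => /eqP; rewrite muln_eq1 => /andP[]; lia.
Qed.

Lemma unitmx_int_det (n : nat) (M M' : 'M[int]_n) :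
  M *m M' = 1%:M -> \det M = 1 \/ \det M = -1.
Proof.
by move=> MM'; apply: (@intmul_eq1 _ (\det M')); rewrite -det_mulmx MM' det1.
Qed.

(** If P conjugates N to its inverse then tr N = tr N^-1, and tr N^-1 is
    tr N / det N; a negative determinant therefore forces the trace to
    vanish. *)
Lemma inverting_trace (N P : 'M[int]_2) :
  P \is a GRing.unit -> N * P * N = P -> \det N = -1 -> \tr N = 0.
Proof.
move=> uP NPN dN.
have NN : N * N = \tr N *: N + 1.
  by rewrite cayley_hamilton2 dN rmorphN opprK.
have tPE : \tr N *: P = N * P - P * N.
  have : N * (N * P * N) = N * P by rewrite NPN.
  rewrite !mulrA NN mulrDl mul1r -scalerAl mulrDl -scalerAl NPN.
  by move/(canRL (addrK _)).
have /(congr1 (fun M => \tr (M * P^-1))) := tPE.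
rewrite -scalerAl divrr // mxtraceZ mxtrace1 mulrBl mulrK //.
rewrite raddfB /= (mxtraceMC (P * N)) mulKr // subrr => /eqP.
by rewrite mulf_eq0 orbF => /eqP.
Qed.

(** From N^-1 = (tr N) I - N the relation N P N = P becomes
    N P + P N = (tr N) P.  Taking traces of this identity and of its product
    with N gives two linear equations in tr P and tr (N P), of determinant
    (tr N)^2 - 4. *)
Lemma inverting_traces0 (N P : 'M[int]_2) :
  \det N = 1 -> \tr N ^+ 2 != 4 -> N * P * N = P ->
  \tr P = 0 /\ \tr (N * P) = 0.
Proof.
move=> dN tN NPN; set t := \tr N in tN *.
have NN : N * N = t *: N - 1 by rewrite cayley_hamilton2 dN.
have tPE : t *: P = N * P + P * N.
  have : N * (N * P * N) = N * P by rewrite NPN.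
  rewrite !mulrA NN mulrBl mul1r -scalerAl mulrBl -scalerAl NPN.
  by move/(canRL (subrK _)).
have e1 : t * \tr P = 2 * \tr (N * P).
  rewrite -(mxtraceZ t) tPE mxtraceD (mxtraceMC P); ring.
have e2 : 2 * \tr P = t * \tr (N * P).
  have /(congr1 mxtrace) : N * P * N = N * P * N by [].
  rewrite {1}NPN mxtraceMC mulrA NN mulrBl mul1r -scalerAl.
  rewrite raddfB /= mxtraceZ => eP.
  by rewrite mulr_natl mulr2n {1}eP subrK.
have P0 : \tr P = 0.
  have /eqP : (t ^+ 2 - 4) * \tr P = 0.
    have -> : (t ^+ 2 - 4) * \tr P = t * (t * \tr P) - 2 * (2 * \tr P) by ring.
    by rewrite e1 e2; ring.
  by rewrite mulf_eq0 subr_eq0 (negbTE tN) => /eqP.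
split=> //; lia.
Qed.

Lemma int_parity (k : int) : exists l, k = 2 * l \/ k = 2 * l + 1.
Proof. exists (k %/ 2)%Z; lia. Qed.

(** A traceless matrix of determinant 1 is a square root of -1, so
    (1 + M) (1 - M) = 2 and the image of 1 - M has index det (1 - M) = 2.
    That image is cut out by a linear form modulo 2 whose coefficients are the
    off-diagonal entries of M. *)
Lemma coker_order2 (M : 'M[int]_2) : \tr M = 0 -> \det M = 1 ->
  exists u : 'cV[int]_2,
    (forall z, u <> (1 - M) *m z) /\
    (forall x, exists z, x = (1 - M) *m z \/ x = u + (1 - M) *m z).
Proof.
rewrite mxtrace2 det2; pose a : int := M 0 0; pose b : int := M 0 1.
pose c : int := M 1 0; rewrite -/a -/b -/c.
move=> /(canRL (addKr _)); rewrite addr0 => d; rewrite d => det1.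
have imE z : (1 - M) *m z = \col_i
    if i == 0 then (1 - a) * z 0 0 - b * z 1 0 else (1 + a) * z 1 0 - c * z 0 0.
  apply/colP=> i; case: (ord2_case i) => ->; rewrite !mxE sum_ord2 !mxE /= ?d;
    rewrite ?mulr0n ?mulr1n -/a -/b -/c; ring.
clearbody a b c => {d}.
have colE2 (x y : 'cV[int]_2) : x 0 0 = y 0 0 -> x 1 0 = y 1 0 -> x = y.
  by move=> e0 e1; apply/colP=> i; case: (ord2_case i) => ->.
(* If (1 + M) x = 2 h then 2 x = (1 - M) (1 + M) x = 2 (1 - M) h. *)
have halfE (x : 'cV[int]_2) (h0 h1 : int) :
    (1 + a) * x 0 0 + b * x 1 0 = 2 * h0 ->
    c * x 0 0 + (1 - a) * x 1 0 = 2 * h1 -> exists z, x = (1 - M) *m z.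
  move=> e0 e1; exists (\col_i if i == 0 then h0 else h1).
  have ea0 := congr1 (fun t => (1 - a) * t) e0.
  have eb1 := congr1 (fun t => b * t) e1.
  have ea1 := congr1 (fun t => (1 + a) * t) e1.
  have ec0 := congr1 (fun t => c * t) e0.
  have dx0 := congr1 (fun t => t * x 0 0) det1.
  have dx1 := congr1 (fun t => t * x 1 0) det1.
  by rewrite imE; apply: colE2; rewrite !mxE /=; lia.
suff [u0 [u1 [uN uP]]] : exists u0 u1 : int,
    (forall z0 z1 : int,
      u0 = (1 - a) * z0 - b * z1 -> u1 <> (1 + a) * z1 - c * z0) /\
    (forall x0 x1 : int, exists s h0 h1 : int, [/\ s = 0 \/ s = 1,
       (1 + a) * (x0 - s * u0) + b * (x1 - s * u1) = 2 * h0 &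
       c * (x0 - s * u0) + (1 - a) * (x1 - s * u1) = 2 * h1]).
  pose u : 'cV[int]_2 := \col_i if i == 0 then u0 else u1.
  exists u; split=> [z|x].
    rewrite imE => /colP uz; apply: (uN (z 0 0) (z 1 0)).
      by have := uz 0; rewrite !mxE.
    by have := uz 1; rewrite !mxE.
  have [s [h0 [h1 [s01 e0 e1]]]] := uP (x 0 0) (x 1 0).
  have [||z xz] := halfE (x - s *: u) h0 h1; rewrite ?mxE //=.
  exists z; rewrite -xz; case: s01 => ->; [left|right].
    by rewrite scale0r subr0.
  by rewrite scale1r addrC subrK.
(* The equation - a^2 - b c = 1 leaves three parity patterns for (a, b, c),
   and s below is the value modulo 2 of c x0 + b x1, the form vanishing on
   the image; u is chosen where this form is odd. *)
have [a' ea] := int_parity a; have [b' eb] := int_parity b.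
have [c' ec] := int_parity c.
case: ea eb ec => ea [] eb [] ec; subst a b c; try (exfalso; lia).
- exists 1, 0; split=> [|x0 x1]; first by lia.
  have [l [el|el]] := int_parity (x0 + x1).
    have -> : x1 = 2 * l - x0 by lia.
    exists 0, ((a' - b') * x0 + (2 * b' + 1) * l),
      ((a' + c') * x0 + (1 - 2 * a') * l); split; lia.
  have -> : x1 = 2 * l - (x0 - 1) by lia.
  exists 1, ((a' - b') * (x0 - 1) + (2 * b' + 1) * l),
    ((a' + c') * (x0 - 1) + (1 - 2 * a') * l); split; lia.
- exists 1, 0; split=> [|x0 x1]; first by lia.
  have [l [->|->]] := int_parity x0.
    by exists 0, ((1 + a') * 2 * l + b' * x1),
      ((2 * c' + 1) * l - a' * x1); split; lia.
  by exists 1, ((1 + a') * 2 * l + b' * x1),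
    ((2 * c' + 1) * l - a' * x1); split; lia.
- exists 0, 1; split=> [|x0 x1]; first by lia.
  have [l [->|->]] := int_parity x1.
    by exists 0, ((1 + a') * x0 + (2 * b' + 1) * l),
      (c' * x0 - 2 * a' * l); split; lia.
  by exists 1, ((1 + a') * x0 + (2 * b' + 1) * l),
    (c' * x0 - 2 * a' * l); split; lia.
Qed.

(** * Counting twisted conjugacy classes *)

Section TwistedClasses.
Variables (G : groupType) (phi : G -> G).
Hypothesis phiM : {morph phi : g h / (g * h)%g}.

Lemma twisted_class_eq x y :
  twisted_class phi x = twisted_class phi y <->
  exists g, (y * phi g)%g = (g * x)%g.
Proof.
split=> [xy|[g yg]].
  have : twisted_class phi y y.
    by exists 1%g; rewrite (morphg1 phiM) invg1 mul1g mulg1.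
  by rewrite -xy => -[g ->]; exists g; rewrite mulgVK.
have xE : x = (g^-1 * y * phi g)%g by rewrite -mulgA yg mulKg.
apply/seteqP; split=> z [h ->].
  by exists (h * g^-1)%g; rewrite xE phiM (morphgV phiM) invgM invgK !mulgA.
exists (h * g)%g; rewrite phiM invgM xE !mulgA; congr (_ * _)%g.
by rewrite !mulgK.
Qed.

Lemma reidemeister_infinite (s : nat -> G) :
  (forall i j, twisted_class phi (s i) = twisted_class phi (s j) -> i = j) ->
  reidemeister_number phi = +oo%E.
Proof.
move=> s_inj; rewrite /reidemeister_number /ecard asboolF //.
apply/infiniteP; pose c n := twisted_class phi (s n).
have c_inj : {in [set: nat] &, injective c} by move=> i j _ _ /s_inj.
rewrite -(card_le_eql (inj_card_eq c_inj)).
by apply: subset_card_le => _ [n _ <-]; exists (s n).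
Qed.

Lemma reidemeister_card (T : finType) (r : T -> G) :
  (forall i j, twisted_class phi (r i) = twisted_class phi (r j) -> i = j) ->
  (forall g, exists i, twisted_class phi g = twisted_class phi (r i)) ->
  reidemeister_number phi = (#|T|%:E)%E.
Proof.
move=> r_inj r_surj; rewrite /reidemeister_number /ecard.
have -> : range (twisted_class phi) =
    [set` [fset twisted_class phi (r i) | i in T]%fset].
  apply/seteqP; split=> [_ [g _ <-]|_ /imfsetP[i _ ->]]; last by exists (r i).
  by have [i ->] := r_surj g; apply/imfsetP; exists i.
rewrite asboolT; last exact: finite_fset.
rewrite set_fsetK card_imfset; last by move=> i j /r_inj.
by rewrite cardE.
Qed.

End TwistedClasses.

(** * Endomorphisms of Pi2 *)

Section Endomorphisms.

Variables (N : 'M[int]_2) (uN : N \is a GRing.unit).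
Variable phi : Pi2 N -> Pi2 N.
Hypothesis phiM : {morph phi : g h / (g * h)%g}.

Local Notation beta := (gen_beta N).
Local Notation vec := (vec uN).
Local Notation ht := (ht uN).
Local Notation a := (a_exp N).

Definition linear_part : 'M[int]_2 := \matrix_(i, j) vec (phi (gen_a N j)) i 0.
Local Notation P := linear_part.
Local Notation e := (ht (phi beta)).

Hypothesis fixfree : \det (1 - N) != 0.

(** The height of phi (a^x) is additive in x and unchanged when x is replaced
    by N x, because the group of heights is abelian.  It therefore vanishes
    on the image of 1 - N, which contains all multiples of
    det (1 - N) by the adjugate formula. *)
Lemma ht_phi_a x : ht (phi (a x)) = 0.
Proof.
have htN y : ht (phi (a (N *m y))) = ht (phi (a y)).
  have /(congr1 (fun g => ht (phi g))) := beta_a_exp N y.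
  by rewrite (phiM beta) (phiM _ beta) !htM addrC => /addIr.
have htD y z : ht (phi (a (y + z))) = ht (phi (a y)) + ht (phi (a z)).
  by rewrite a_expD phiM htM.
pose y := \adj (1 - N) *m x.
have yx : y = \det (1 - N) *: x + N *m y.
  have <- : (1 - N) *m y = \det (1 - N) *: x.
    by rewrite mulmxA mul_mx_adj mul_scalar_mx.
  by rewrite mulmxBl mul1mx subrK.
have := congr1 (fun z => ht (phi (a z))) yx; rewrite htD htN.
rewrite -[LHS]add0r => /addIr.
rewrite -(expgz_scale (a_expD N)) (morphg_expgz phiM) ht_expgz.
by move=> /esym/eqP; rewrite mulf_eq0 (negbTE fixfree) => /eqP.
Qed.

Lemma phi_gen_a i : phi (gen_a N i) = a (col i P).
Proof.
apply: (coord_inj (uN := uN)); last by rewrite -a_exp_delta ht_phi_a ht_a_exp.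
by rewrite vec_a_exp; apply/colP=> j; rewrite !mxE.
Qed.

Lemma phi_a_exp x : phi (a x) = a (P *m x).
Proof. exact: morph_a_exp phiM phi_gen_a x. Qed.

Lemma ht_phi g : ht (phi g) = ht g * e.
Proof.
rewrite {1}(coordE uN g) phiM htM ht_phi_a add0r.
by rewrite (morphg_expgz phiM) ht_expgz.
Qed.

(** Apply phi to the relation beta a^x = a^(N x) beta. *)
Lemma linear_part_intertwines : N ^ e *m P = P *m N.
Proof.
apply/matrixP=> i j; have /(congr1 phi) := beta_a_exp N (delta_mx j 0).
(* The factors are given explicitly because a_exp is itself a product, which
   the morphism laws would split further. *)
rewrite (phiM beta) (phiM _ beta) !phi_a_exp => /(congr1 vec).
rewrite (vecM _ (phi beta)) (vecM _ (a _) (phi beta)) !vec_a_exp ht_a_exp.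
rewrite expr0z mul1mx addrC => /addIr.
by rewrite !mulmxA -!colE => /colP/(_ i); rewrite !mxE.
Qed.

Hypothesis phi_surj : forall g, exists h, phi h = g.

Lemma ht_phi_beta : e = 1 \/ e = -1.
Proof.
have [g pg] := phi_surj beta; apply: (@intmul_eq1 _ (ht g)).
by rewrite mulrC -ht_phi pg ht_beta.
Qed.

Lemma linear_part_surj (y : 'cV[int]_2) : exists x, P *m x = y.
Proof.
have [g pg] := phi_surj (a y); exists (vec g).
have g0 : ht g = 0.
  have := ht_phi g; rewrite pg ht_a_exp => /esym/eqP; rewrite mulf_eq0.
  by case: ht_phi_beta => ->; rewrite orbF => /eqP.
apply: (a_exp_inj uN); rewrite -phi_a_exp -pg; congr phi.
by rewrite [RHS](coordE uN) g0 mulg1.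
Qed.

Lemma linear_part_unit : P \is a GRing.unit /\ (\det P = 1 \/ \det P = -1).
Proof.
have [x0 x0E] := linear_part_surj (delta_mx 0 0).
have [x1 x1E] := linear_part_surj (delta_mx 1 0).
have PK : P *m (\matrix_(i, j) (if j == 0 then x0 else x1) i 0) = 1%:M.
  apply/matrixP=> i j.
  transitivity ((P *m (if j == 0 then x0 else x1)) i 0).
    by rewrite !mxE; apply: eq_bigr => k _; rewrite mxE.
  by case: (ord2_case j) => -> /=; rewrite (x0E, x1E) !mxE eqxx andbT.
by split; [have [] := mulmx1_unit PK | apply: unitmx_int_det PK].
Qed.

(** When e = 1, twisted conjugation preserves heights. *)
Lemma reidemeister_ht_fixed : e = 1 -> reidemeister_number phi = +oo%E.
Proof.
move=> e1; apply: (@reidemeister_infinite _ _ (fun n : nat => expgz beta n)).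
move=> i j /(twisted_class_eq phiM)[g /(congr1 ht)].
rewrite !htM ht_phi e1 !ht_expgz ht_beta !mulr1 addrC => /addrI; lia.
Qed.

Section HeightReversed.
Hypothesis eN1 : e = -1.

(** Conjugation by an element of height k shifts the height by 2 k, so
    elements of equal height are twisted conjugate only through some a^z. *)
Lemma twisted_class_same_ht x y : ht x = ht y ->
  twisted_class phi x = twisted_class phi y <->
  exists z, vec y = vec x + (1 - N ^ ht x * P) *m z.
Proof.
move=> hxy; rewrite (twisted_class_eq phiM); split=> [[g gE]|[z zE]].
  exists (vec g).
  have g0 : ht g = 0.
    by have := congr1 ht gE; rewrite !htM ht_phi eN1 hxy; lia.
  have gE' : g = a (vec g) by rewrite {1}(coordE uN g) g0 /= mulg1.
  have := congr1 vec gE; rewrite {1}gE' phi_a_exp (vecM _ y) (vecM _ g).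
  rewrite vec_a_exp g0 expr0z mul1mx.
  rewrite -hxy mulmxA => /(canRL (addrK _)) ->.
  by rewrite mulmxBl mul1mx mulmxE addrA [vec x + _]addrC.
exists (a z); apply: (coord_inj (uN := uN)).
  rewrite phi_a_exp (vecM _ y) (vecM _ (a z)) !vec_a_exp ht_a_exp.
  rewrite expr0z mul1mx zE -hxy.
  by rewrite mulmxBl mul1mx -mulmxE mulmxA addrA subrK addrC.
by rewrite (htM _ y) (htM _ (a z)) ht_phi ht_a_exp mul0r addr0 add0r.
Qed.

(** With P^2 = 1 the vector (1 + P) x is constant on the
    twisted classes of the elements a^x, and 1 + P is nonzero since its trace is 2. *)
Lemma reidemeister_reflection :
  \tr P = 0 -> \det P = -1 -> reidemeister_number phi = +oo%E.
Proof.
move=> trP detP.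
have PP : (1 + P) * (1 - P) = 0.
  by rewrite mulrBr mulr1 mulrDl mul1r cayley_hamilton2 trP detP scale0r sub0r
    rmorphN opprK [P + 1]addrC subrr.
have [j uj] : exists j, (1 + P) *m delta_mx j 0 != 0 :> 'cV[int]_2.
  have : (1 + P) 0 0 + (1 + P) 1 1 = 2.
    by rewrite -mxtrace2 raddfD /= mxtrace1 trP addr0.
  move=> tr2; case: (eqVneq ((1 + P) 0 0) 0) => [z0|nz0]; [exists 1|exists 0].
    apply/eqP; rewrite -colE => /colP/(_ 1); rewrite mxE [RHS]mxE => z1.
    by rewrite z0 z1 in tr2.
  by apply/eqP; rewrite -colE => /colP/(_ 0); rewrite mxE [RHS]mxE; apply/eqP.
pose s (n : nat) := a (n%:Z *: delta_mx j 0).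
apply: (@reidemeister_infinite _ _ s) => m n.
have hs k : ht (s k) = 0 by rewrite ht_a_exp.
case/twisted_class_same_ht => [|z]; first by rewrite !hs.
rewrite hs expr0z mul1r !vec_a_exp => /(congr1 (mulmx (1 + P))).
rewrite mulmxDr mulmxA mulmxE PP mul0mx addr0 -!scalemxAr => /eqP.
by rewrite -subr_eq0 -scalerBl scalemx_eq0 (negbTE uj) orbF subr_eq0 => /eqP [].
Qed.

(** Every height can be moved to 0 or 1, and parity of the height separates
    the two cases.  On each of these two layers the classes form the cokernel
    of 1 - N^k P, of order 2. *)
Lemma reidemeister_rotation :
  \tr P = 0 -> \det P = 1 -> \tr (N * P) = 0 -> \det (N * P) = 1 ->
  reidemeister_number phi = 4%:E%E.
Proof.
move=> trP detP trNP detNP.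
have [u0 [u0N u0P]] := coker_order2 trP detP.
have [u1 [u1N u1P]] := coker_order2 trNP detNP.
pose u (b : bool) := if b then u1 else u0.
have uN' (b : bool) z : u b <> (1 - N ^ b%:Z * P) *m z.
  by case: b z; rewrite /= (expr0z, expr1z) ?mul1r.
have uP (b : bool) x :
    exists c z, x = (1 - N ^ b%:Z * P) *m z + (c : bool)%:Z *: u b.
  have [z [->|->]] : exists z, x = (1 - N ^ b%:Z * P) *m z \/
      x = u b + (1 - N ^ b%:Z * P) *m z.
    by case: b; rewrite /= (expr0z, expr1z) ?mul1r.
    by exists false, z; rewrite scale0r addr0.
  by exists true, z; rewrite scale1r addrC.
pose r (i : bool * bool) := (a (i.2%:Z *: u i.1) * expgz beta i.1)%g.
have hr i : ht (r i) = i.1%:Z.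
  by rewrite htM ht_a_exp ht_expgz ht_beta add0r mulr1.
have vr i : vec (r i) = i.2%:Z *: u i.1.
  by rewrite vecM vec_a_exp vec_beta_exp mulmx0 addr0.
rewrite (@reidemeister_card _ _ _ r) ?card_prod ?card_bool //.
  move=> [b c] [b' c'] rr.
  have eb : b = b'.
    have [g /(congr1 ht)] := (twisted_class_eq phiM _ _).1 rr.
    rewrite (htM _ (r _)) (htM _ g) ht_phi eN1 !hr /=.
    by case: (b) (b') => [] []; lia.
  rewrite {}eb in rr *; congr pair; move: rr.
  case/twisted_class_same_ht => [|z]; first by rewrite !hr.
  rewrite !vr hr /=; case: c c' => [] [] //; rewrite ?scale1r ?scale0r.
    by move=> /esym/eqP; rewrite addr_eq0 -mulmxN => /eqP/uN'.
  by rewrite add0r => /uN'.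
move=> g.
have [h [b hb]] : exists h, exists b : bool,
    twisted_class phi g = twisted_class phi h /\ ht h = b%:Z.
  have [l lE] := int_parity (ht g).
  pose c := expgz beta (- l); exists (c * g * (phi c)^-1)%g, (ht g != 2 * l).
  split.
    by apply/(twisted_class_eq phiM); exists c; rewrite mulgVK.
  by rewrite !htM htV ht_phi eN1 ht_expgz ht_beta; lia.
have [c [z zE]] := uP b (vec h).
exists (b, c); rewrite hb.1; apply/esym/twisted_class_same_ht.
  by rewrite hr hb.2.
by exists z; rewrite hr vr zE addrC.
Qed.

End HeightReversed.
End Endomorphisms.

(** * The square roots N_+ and N_- *)

(** Compare determinants and traces in A + e = - s N, where
    s^2 = tr A + 2 e, using det (A + e) = e (tr A + 2 e) and
    tr (A + e) = tr A + 2 e. *)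
Lemma integral_root_invariants (R : realType) (A N : 'M[int]_2) (e : int) :
  \det A = 1 -> 2 < \tr A -> e = 1 \/ e = -1 ->
  is_integral_form (root_mx R A e) N ->
  \det N = e /\ \tr N ^+ 2 = \tr A + 2 * e.
Proof.
move=> detA trA e1; rewrite /is_integral_form /root_mx.
set t : int := \tr A + 2 * e; set s := Num.sqrt _ => Nform.
have t_gt0 : 0 < t by rewrite /t; case: e1 => ->; lia.
have tR : (t%:~R : R) != 0 by rewrite intr_eq0 gt_eqF.
have ss : s ^+ 2 = t%:~R by rewrite sqr_sqrtr // ler0z ltW.
have s0 : s != 0 by apply: contra_neq tR => s0; rewrite -ss s0 expr0n.
have rootE : map_mx intr (A + e%:M) = (- s) *: map_mx intr N :> 'M[R]_2.
  by rewrite -Nform scalerA mulrNN divff // scale1r.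
have detAe : \det (A + e%:M) = e * t.
  rewrite /t; move: detA; rewrite !det2 mxtrace2 !mxE /= !mulr1n !mulr0n.
  by case: e1 => -> d; lia.
have trAe : \tr (A + e%:M) = t by rewrite raddfD /= mxtrace_scalar /t mulr_natl.
split.
  have /(congr1 determinant) := rootE.
  rewrite det_map_mx detZ det_map_mx detAe sqrrN ss /= intrM mulrC.
  by move=> /(mulfI tR)/intr_inj.
have /(congr1 (fun M => (\tr M) ^+ 2)) := rootE.
rewrite mxtraceZ !trace_map_mx trAe exprMn sqrrN ss /= expr2.
by move=> /(mulfI tR) tE; apply: (@intr_inj R); rewrite tE rmorphXn.
Qed.

(** * Type and determinant of an automorphism *)

Section Types.
Variables (N : 'M[int]_2) (uN : N \is a GRing.unit).
Variable phi : Pi2 N -> Pi2 N.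
Hypothesis phiM : {morph phi : g h / (g * h)%g}.
Hypothesis fixfree : \det (1 - N) != 0.

Local Notation P := (linear_part uN phi).
Local Notation e := (ht uN (phi (gen_beta N))).

(** Vector and height of the images determine all exponents. *)
Lemma restriction_dataP n p m :
  restriction_data phi n p m <->
  [/\ n = P, m = e & p = vec uN (phi (gen_t N))].
Proof.
have htt : ht uN (gen_t N) = 2 by rewrite htM ht_beta.
have vect k : vec uN (expgz (gen_t N) k) = 0.
  by apply: vec_expgz0; rewrite vecM vec_beta mulmx0 addr0.
split=> [[na nt]|[-> -> ->]].
  split.
  - apply/matrixP=> i j; have := na j; rewrite (phi_gen_a uN phiM fixfree).
    by move=> /(a_exp_inj uN)/colP/(_ i); rewrite !mxE.
  - have /(congr1 (ht uN)) := nt.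
    rewrite ht_phi // (htM _ (a_exp N p)) ht_a_exp ht_expgz htt; lia.
  by rewrite nt (vecM _ (a_exp N p)) vec_a_exp vect mulmx0 addr0.
split=> [i|]; first exact: phi_gen_a.
apply: (coord_inj (uN := uN)).
  by rewrite (vecM _ (a_exp N _)) vec_a_exp vect mulmx0 addr0.
rewrite (htM _ (a_exp N _)) ht_a_exp ht_expgz htt ht_phi // htt; lia.
Qed.

Lemma is_type_IIP : is_type_II phi <-> e = -1.
Proof.
split=> [[n [p /restriction_dataP[_ <-]]] //|eN1].
by exists P, (vec uN (phi (gen_t N))); apply/restriction_dataP; rewrite eN1.
Qed.

Lemma det_restriction_eqP d : det_restriction_eq phi d <-> d = e * \det P.
Proof.
split=> [[n [p [m [/restriction_dataP[-> -> _] ->]]]] //|->].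
by exists P, (vec uN (phi (gen_t N))), e; split=> //; apply/restriction_dataP.
Qed.

End Types.

Lemma bijective_onto (T U : Type) (f : T -> U) :
  bijective f -> forall y, exists x, f x = y.
Proof. by case=> g _ gK y; exists (g y). Qed.

Theorem theorem3p2 (R : realType) (A : 'M[int]_2)
    (detA : \det A = 1) (trA : 2 < \tr A) :
  (forall N : 'M[int]_2, is_integral_form (root_mx R A 1) N ->
     forall phi : {multiplicative Pi2 N -> Pi2 N}, bijective phi ->
       reidemeister_number phi =
         if `[< is_type_II phi /\ det_restriction_eq phi (-1) >]
         then (4%N)%:E else +oo%E)
  /\
  (forall N : 'M[int]_2, is_integral_form (root_mx R A (-1)) N ->
     R_infinity (Pi2 N)).
Proof.
split=> N rootN.
  have [detN trN] := integral_root_invariants detA trA (or_introl erefl) rootN.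
  have uN : N \is a GRing.unit by rewrite [_ \is a _]unitmxE detN.
  have trN2 : \tr N <> 2.
    by move=> tr2; move: trA trN; rewrite tr2; set x : int := \tr A; lia.
  have fixN : \det (1 - N) != 0.
    by rewrite det_sub1 detN; set x : int := \tr N in trN2 *; lia.
  have tr4 : \tr N ^+ 2 != 4.
    by rewrite trN; move: trA; set x : int := \tr A; lia.
  move=> phi phi_bij; have phi_surj := bijective_onto phi_bij.
  have phiM : {morph phi : g h / (g * h)%g} by apply: gmulfM.
  pose P := linear_part uN phi; pose e := ht uN (phi (gen_beta N)).
  have [uP detP] := linear_part_unit uN phiM fixN phi_surj.
  have typeII := is_type_IIP uN phiM fixN.
  have detE := det_restriction_eqP uN phiM fixN.
  case: (ht_phi_beta uN phiM fixN phi_surj) => [e1|eN1].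
    rewrite asboolF; first exact: reidemeister_ht_fixed e1.
    by case=> /typeII; rewrite e1.
  have NPN : N * P * N = P.
    have := linear_part_intertwines uN phiM fixN.
    rewrite eN1 exprN1 !mulmxE => PN.
    by rewrite -mulrA -PN mulVKr.
  have [trP trNP] := inverting_traces0 detN tr4 NPN.
  case: detP => detP.
    rewrite asboolT; last first.
      by split; [exact/typeII | apply/detE; rewrite eN1 detP].
    apply: reidemeister_rotation => //; by rewrite -mulmxE det_mulmx detN detP.
  rewrite asboolF; last by case=> _ /detE; rewrite eN1 detP.
  exact: reidemeister_reflection.
have [detN trN] := integral_root_invariants detA trA (or_intror erefl) rootN.
have uN : N \is a GRing.unit by rewrite [_ \is a _]unitmxE detN.
have trN0 : \tr N <> 0.
  by move=> tr0; move: trA trN; rewrite tr0; set x : int := \tr A; lia.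
have fixN : \det (1 - N) != 0.
  by rewrite det_sub1 detN; set x : int := \tr N in trN0 *; lia.
move=> phi phi_bij; have phi_surj := bijective_onto phi_bij.
have phiM : {morph phi : g h / (g * h)%g} by apply: gmulfM.
have [uP _] := linear_part_unit uN phiM fixN phi_surj.
case: (ht_phi_beta uN phiM fixN phi_surj) => [e1|eN1].
  exact: reidemeister_ht_fixed e1.
exfalso; apply: trN0; apply: inverting_trace uP _ detN.
have := linear_part_intertwines uN phiM fixN; rewrite eN1 exprN1 !mulmxE => PN.
by rewrite -mulrA -PN mulVKr.
Qed.
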